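(* Let $A$ be a set equipped with a ternary operation $p\colon A^3\to A$ and two constants $0,1\in A$ such that for all $a,b,c,b_1,b_2,b_3\in A$: (C1) $p(0,a,1)=a$; (C2) $p(a,b,a)=a$; (C3) $p(a,p(b_1,b_2,b_3),c)=p(p(a,b_1,c),b_2,p(a,b_3,c))$; (C4) $p(a,0,b)=a=p(b,1,a)$. Define binary operations $a\wedge b=p(0,a,b)$, $a\vee b=p(a,b,1)$ and a unary operation $\bar{a}=p(1,a,0)$. Suppose that $\wedge$ is commutative (or that $\vee$ is commutative). Then the following conditions are equivalent: (i) $(A,\vee,\wedge,\bar{()},0,1)$ is a Boolean algebra (with join $\vee$, meet $\wedge$, complement $\bar{()}$, bottom $0$ and top $1$); (ii) $p(a,b,c)=(\bar{b}\wedge a)\vee(b\wedge c)$ for all $a,b,c\in A$; (iii) $p(a,a,b)=p(0,a,b)$ for all $a,b\in A$. *)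

(* Defs.v *)
From mathcomp Require Import all_boot.
Set Implicit Arguments.
Unset Strict Implicit.
Unset Printing Implicit Defensive.

Section TernaryOperations.
Variables (A : Type) (p : A -> A -> A -> A) (zero one : A).

Definition tmeet (a b : A) : A := p zero a b.
Definition tjoin (a b : A) : A := p a b one.
Definition tcompl (a : A) : A := p one a zero.

End TernaryOperations.

(* A complemented bounded distributive lattice, as a property of operations on
   a bare type: mathcomp's ctbDistrLatticeType bundles the operations with a
   choiceType carrier, so it cannot be asserted of given operations on an
   arbitrary A. The one-element algebra (bot = top) is allowed. *)
Record is_boolean_algebra (A : Type) (join meet : A -> A -> A)
    (compl : A -> A) (bot top : A) : Prop := IsBooleanAlgebra {
  ba_joinC : commutative join;
  ba_meetC : commutative meet;
  ba_joinA : associative join;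
  ba_meetA : associative meet;
  ba_joinKI : forall a b, meet a (join a b) = a;
  ba_meetKU : forall a b, join a (meet a b) = a;
  ba_meetUr : right_distributive meet join;
  ba_joinIr : right_distributive join meet;
  ba_join0 : left_id bot join;
  ba_meet1 : left_id top meet;
  ba_joinN : right_inverse top compl join;
  ba_meetN : right_inverse bot compl meet
}.

(* Main.v *)
(* Reading p a b c as "if b then c else a", De Morgan duality holds with no extra
   hypothesis, so commutativity of one of meet, join gives it for both.

   Idempotence-like law => Boolean algebra: commuting the two meet factors in the
   middle of p gives p x b (p x a y) = p x a (p x b y), and with p a a b = p 0 a b
   this turns into the absorption laws; distributivity follows.

   Boolean algebra => formula: both (. /\ d) and (. \/ d) commute with p (.) b (.),
   which forces b /\ p a b c = b /\ c; by symmetry b' /\ p a b c = b' /\ a, and an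
   element is the join of its meets with b' and b.

   Formula => idempotence-like law: evaluating the formula at p 1 b 1 = 1 gives
   b' \/ b = 1, hence b' /\ b = 0 by duality. *)
Require Import Defs.
From mathcomp Require Import all_boot.

Section ConditionalAlgebra.
Variables (A : Type) (p : A -> A -> A -> A) (zero one : A).
Hypothesis p01 : forall a, p zero a one = a.
Hypothesis pxx : forall a b, p a b a = a.
Hypothesis p_distr : forall a b1 b2 b3 c,
  p a (p b1 b2 b3) c = p (p a b1 c) b2 (p a b3 c).
Hypothesis p_ends : forall a b, p a zero b = a /\ a = p b one a.

Local Notation meet := (tmeet p zero).
Local Notation join := (tjoin p one).
Local Notation compl := (tcompl p zero one).

Lemma p_zero a b : p a zero b = a.
Proof. by case: (p_ends a b). Qed.

Lemma p_one a b : p a one b = b.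
Proof. by case: (p_ends b a). Qed.

Lemma p_compl a b c : p a (compl b) c = p c b a.
Proof. by rewrite /tcompl p_distr p_one p_zero. Qed.

Lemma complK : involutive compl.
Proof. by move=> a; rewrite {1}/tcompl p_compl p01. Qed.

Lemma compl_p a b c : compl (p a b c) = p (compl a) b (compl c).
Proof. by rewrite /tcompl p_distr. Qed.

(** [p_compl] swaps the outer arguments of [p], hence the reversed order of the factors. *)
Lemma compl_meet a b : compl (meet a b) = join (compl b) (compl a).
Proof. by rewrite /tmeet compl_p {1}/tcompl p_zero /tjoin p_compl. Qed.

Lemma compl_join a b : compl (join a b) = meet (compl b) (compl a).
Proof. by rewrite /tjoin compl_p {2}/tcompl p_one /tmeet p_compl. Qed.

Lemma tmeetA : associative meet.
Proof. by move=> a b c; rewrite /tmeet p_distr p_zero. Qed.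

Lemma tjoinA : associative join.
Proof. by move=> a b c; rewrite /tjoin p_distr p_one. Qed.

Lemma tjoin0 : left_id zero join.
Proof. by move=> a; exact: p01. Qed.

Lemma tmeet1 : left_id one meet.
Proof. by move=> a; exact: p_one. Qed.

Lemma tmeet_p a b c d : meet (p a b c) d = p (meet a d) b (meet c d).
Proof. exact: p_distr. Qed.

Lemma tjoin_p a b c d : join d (p a b c) = p (join d a) b (join d c).
Proof. exact: p_distr. Qed.

Lemma tjoinC_of_tmeetC : commutative meet -> commutative join.
Proof.
by move=> mC a b; apply: (can_inj complK); rewrite !compl_join mC.
Qed.

Lemma tmeetC_of_tjoinC : commutative join -> commutative meet.
Proof.
by move=> jC a b; apply: (can_inj complK); rewrite !compl_meet jC.
Qed.

Section BooleanOfDiagonal.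
Hypothesis meetC : commutative meet.
Hypothesis joinC : commutative join.
Hypothesis p_diag : forall a b, p a a b = p zero a b.

Lemma p_exchange x a b y : p x a (p x b y) = p x b (p x a y).
Proof.
have E u v : p x (meet u v) y = p x u (p x v y).
  by rewrite /tmeet p_distr p_zero.
by rewrite -!E meetC.
Qed.

(** [p_diag] turns the left end [zero] into [a], so both nested [p] share that end and can be
    exchanged; the inner one is then [p a a one], which is [a]. *)
Lemma diag_joinKI a b : meet a (join a b) = a.
Proof. by rewrite /tmeet -p_diag /tjoin p_exchange p_diag p01 pxx. Qed.

Lemma diag_meetKU a b : join a (meet a b) = a.
Proof.
by rewrite /tjoin /tmeet p_distr p_zero p_diag; exact: diag_joinKI.
Qed.

(** Both sides reduce to [p a b (join a c)]. *)
Lemma diag_joinIr : right_distributive join meet.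
Proof.
move=> a b c; rewrite {1}/tjoin {1}/tmeet p_distr p_zero.
by rewrite [join a b in RHS]/tjoin tmeet_p diag_joinKI tmeet1.
Qed.

(** The usual lattice argument: expand the right side by the dual law, then absorb twice. *)
Lemma diag_meetUr : right_distributive meet join.
Proof.
move=> a b c; rewrite diag_joinIr (joinC _ a) diag_meetKU.
by rewrite (joinC (meet a b)) diag_joinIr tmeetA (joinC c a) diag_joinKI (joinC c b).
Qed.

Lemma diag_meetN : right_inverse zero compl meet.
Proof. by move=> a; rewrite meetC /tmeet p_compl p_diag pxx. Qed.

Lemma diag_joinN : right_inverse one compl join.
Proof.
move=> a; rewrite -{1}[a]complK -compl_meet diag_meetN.
by rewrite /tcompl p_zero.
Qed.

Lemma boolean_of_diag : is_boolean_algebra join meet compl zero one.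
Proof.
split; [exact: joinC | exact: meetC | exact: tjoinA | exact: tmeetA
  | exact: diag_joinKI | exact: diag_meetKU | exact: diag_meetUr
  | exact: diag_joinIr | exact: tjoin0 | exact: tmeet1
  | exact: diag_joinN | exact: diag_meetN].
Qed.

End BooleanOfDiagonal.

Section FormulaOfBoolean.
Hypothesis bA : is_boolean_algebra join meet compl zero one.

Let meetC := ba_meetC bA.
Let joinC := ba_joinC bA.
Let joinKI := ba_joinKI bA.
Let meetKU := ba_meetKU bA.

(** With [a] and [c] below [b], the extreme cases are [p a b one = b] and [p a b zero = zero].
    Meeting the first and joining the second with [c] bounds [p a b c] by [c] from both sides. *)
Lemma p_below a b c : meet b a = a -> meet b c = c -> p a b c = c.
Proof.
move=> ab cb.
(* Both [meet (p a b c) c] and [meet (p a b one) c] become [p (meet a c) b c]. *)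
have c_le : meet (p a b c) c = c.
  have pa1 : p a b one = b by rewrite -[LHS]/(join a b) -ab joinC meetKU.
  have meetcc : meet c c = c by rewrite -{2}(meetKU c c) joinKI.
  by rewrite -[in RHS]cb -{2}pa1 !tmeet_p tmeet1 meetcc.
have pa0 : p a b zero = zero.
  by rewrite -p_compl -[LHS]/(meet (compl b) a) -ab (ba_meetA bA)
             (meetC (compl b)) (ba_meetN bA) /tmeet p_zero.
have c_ge : join c (p a b c) = c.
  have joincc : join c c = c by rewrite -{2}(joinKI c c) meetKU.
  have join_c0 : join c zero = c by rewrite /tjoin p_zero.
  by rewrite -[in RHS]join_c0 -pa0 !tjoin_p joincc join_c0.
by rewrite -[RHS]c_ge joinC -[X in join _ X]c_le meetKU.
Qed.

Lemma meet_p_branch a b c : meet b (p a b c) = meet b c.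
Proof.
have meetbb : meet b b = b by rewrite -{2}(meetKU b b) joinKI.
rewrite meetC tmeet_p (meetC a) (meetC c).
by apply: p_below; rewrite tmeetA meetbb.
Qed.

Lemma formula_of_boolean a b c :
  p a b c = join (meet (compl b) a) (meet b c).
Proof.
(* Since [p c (compl b) a] is [p a b c], both meets contain the same element, which factors out. *)
rewrite -(meet_p_branch a b c) -(meet_p_branch c (compl b) a) p_compl.
rewrite (meetC (compl b)) (meetC b) -(ba_meetUr bA) (joinC (compl b)).
by rewrite (ba_joinN bA) meetC tmeet1.
Qed.

End FormulaOfBoolean.

Lemma diag_of_formula :
  (forall a b c, p a b c = join (meet (compl b) a) (meet b c)) ->
  forall a b, p a a b = p zero a b.
Proof.
move=> pE a b; have joinN : join (compl a) a = one.
  have meet_1 x : meet x one = x by exact: p01.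
  by have := pE one a one; rewrite pxx !meet_1.
(* Complementing [joinN]: the reversal in [compl_join] gives exactly this order of factors. *)
have meetN : meet (compl a) a = zero.
  by have := compl_join (compl a) a; rewrite joinN complK /tcompl p_one.
by rewrite pE meetN tjoin0.
Qed.

End ConditionalAlgebra.

Theorem theorem1 (A : Type) (p : A -> A -> A -> A) (zero one : A)
  (C1 : forall a : A, p zero a one = a)
  (C2 : forall a b : A, p a b a = a)
  (C3 : forall a b1 b2 b3 c : A,
      p a (p b1 b2 b3) c = p (p a b1 c) b2 (p a b3 c))
  (C4 : forall a b : A, p a zero b = a /\ a = p b one a)
  (Hcomm : commutative (tmeet p zero) \/ commutative (tjoin p one)) :
  (is_boolean_algebra (tjoin p one) (tmeet p zero) (tcompl p zero one) zero one
   <->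
   (forall a b c : A,
      p a b c = tjoin p one (tmeet p zero (tcompl p zero one b) a)
                            (tmeet p zero b c)))
  /\
  ((forall a b c : A,
      p a b c = tjoin p one (tmeet p zero (tcompl p zero one b) a)
                            (tmeet p zero b c))
   <->
   (forall a b : A, p a a b = p zero a b)).
Proof.
have [mC jC] : commutative (tmeet p zero) /\ commutative (tjoin p one).
  case: Hcomm => HC; split=> //.
  - exact: tjoinC_of_tmeetC _ _ _ _ C1 C3 C4 HC.
  - exact: tmeetC_of_tjoinC _ _ _ _ C1 C3 C4 HC.
have i_ii := formula_of_boolean _ _ _ _ C3 C4.
have ii_iii := diag_of_formula _ _ _ _ C1 C2 C3 C4.
have iii_i := boolean_of_diag _ _ _ _ C1 C2 C3 C4 mC jC.
split; split=> H.
- exact: i_ii.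
- exact/iii_i/ii_iii.
- exact: ii_iii.
- exact/i_ii/iii_i.
Qed.
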